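(* Let $x$, $y$ and $z$ be three points in a proper convex domain $\Omega\subset\mathbb{R}^n$. We have $H_\Omega(x,y)+H_\Omega(y,z)=H_\Omega(x,z)$ if and only if both triples of boundary points $a_\Omega(x,y),a_\Omega(y,z),a_\Omega(x,z)$ and $a_\Omega(y,x),a_\Omega(z,y),a_\Omega(z,x)$ are aligned in $\mathbb{RP}^n$.
   Context: A proper convex domain in $\mathbb{R}^n$ is a non-empty open convex subset $\Omega\neq\mathbb{R}^n$. View $\mathbb{R}^n$ as an affine space in $\mathbb{RP}^n$ with hyperplane at infinity $H_\infty=\mathbb{RP}^n\setminus\mathbb{R}^n$. For $x\ne y$ in $\Omega$ let $R(x,y)=\{x+t(y-x): t\ge 0\}$; $a_\Omega(x,y)\in\mathbb{RP}^n$ is the intersection of the closure of $R(x,y)$ in $\mathbb{RP}^n$ with the boundary of $\Omega$ in $\mathbb{RP}^n$, understood as a single point: the point of $R(x,y)\cap\partial\Omega$ if $R(x,y)\not\subset\Omega$, and the point at infinity of $R(x,y)$ if $R(x,y)\subset\Omega$. The Funk metric is $F_\Omega(x,x)=0$ and, for $x\neq y$ and $a=a_\Omega(x,y)$, $F_\Omega(x,y)=\log\frac{|x-a|}{|y-a|}$ if $a\notin H_\infty$ and $F_\Omega(x,y)=0$ if $a\in H_\infty$. The Hilbert metric is $H_\Omega(x,y)=\frac12\left(F_\Omega(x,y)+F_\Omega(y,x)\right)$.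
   Formalization: The three points are taken pairwise distinct, and if they are collinear then y is assumed to lie in [x,z] or the whole line to lie in Ω; otherwise the claim fails, e.g. Ω=(0,1), x=1/5, y=4/5, z=1/2, where both triples are aligned but the triangle inequality is strict. *)

(* Defs.v *)
From HB Require Import structures.
From mathcomp Require Import all_boot all_order all_algebra.
From mathcomp Require Import all_classical all_reals all_analysis.

Set Implicit Arguments.
Unset Strict Implicit.
Unset Printing Implicit Defensive.

Import Order.TTheory GRing.Theory Num.Theory.
Import numFieldNormedType.Exports.

Local Open Scope classical_set_scope.
Local Open Scope ring_scope.

Section ProjectiveSpace.
Context {R : realType} {n : nat}.

(* A point of RP^n is a line through the origin of R^(1+n); the first
   coordinate is the homogenizing one. *)
Definition RPspace := {L : {vspace 'rV[R]_(1 + n)} | \dim L == 1%N}.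

Fact origin_subproof : \dim <[row_mx 1 0 : 'rV[R]_(1 + n)]>%VS == 1%N.
Proof.
rewrite dim_vline; suff -> : (row_mx 1 0 : 'rV[R]_(1 + n)) != 0 by [].
rewrite -row_mx0; apply/eqP => /eq_row_mx[/eqP].
by rewrite oner_eq0.
Qed.

Definition RPorigin : RPspace := Sub <[row_mx 1 0]>%VS origin_subproof.

(* The class of a nonzero vector; the value at 0 is a dummy. *)
Definition RPclass (v : 'rV[R]_(1 + n)) : RPspace := insubd RPorigin <[v]>%VS.

Lemma val_RPclass (v : 'rV[R]_(1 + n)) :
  v != 0 -> val (RPclass v) = <[v]>%VS.
Proof. by move=> v0; rewrite val_insubd dim_vline v0. Qed.

Definition affpt (x : 'rV[R]_n) : RPspace := RPclass (row_mx 1 x).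

Definition infpt (v : 'rV[R]_n) : RPspace := RPclass (row_mx 0 v).

Definition Hinf : set RPspace := ~` range affpt.

(* Inverse of the chart affpt; meaningful outside Hinf only. *)
Definition affcoord (p : RPspace) : 'rV[R]_n := get [set x | affpt x = p].

(* The projective lines of RP^n are the planes through 0 of R^(1+n). *)
Definition aligned (p q r : RPspace) : Prop :=
  exists W : {vspace 'rV[R]_(1 + n)},
    [/\ \dim W = 2%N, (val p <= W)%VS, (val q <= W)%VS & (val r <= W)%VS].

End ProjectiveSpace.

Arguments RPspace : clear implicits.

Section FunkHilbert.
Context {R : realType} {n : nat}.
Implicit Types (Omega : set 'rV[R]_n) (x y : 'rV[R]_n).

Definition proper_convex_domain Omega : Prop :=
  [/\ Omega !=set0, open Omega,
      convex_set (Omega : set (convex_lmodType 'rV[R]_n)) & Omega <> setT].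

(* The library norm on row vectors is the sup norm. *)
Definition enorm x : R := Num.sqrt (\sum_(i < n) x 0 i ^+ 2).

Definition ray x y : set 'rV[R]_n :=
  [set x + t *: (y - x) | t in [set t : R | 0 <= t]].

Definition boundary Omega : set 'rV[R]_n := closure Omega `\` interior Omega.

(* For x != y in a convex domain Omega, ray x y meets the boundary in exactly
   one point as soon as it leaves Omega, so `get` is not a choice here. *)
Definition bdpt Omega x y : RPspace R n :=
  if `[< ray x y `<=` Omega >] then infpt (y - x)
  else affpt (get (ray x y `&` boundary Omega)).

Definition Funk Omega x y : R :=
  if x == y then 0 else
  let a := bdpt Omega x y in
  if `[< Hinf a >] then 0
  else ln (enorm (x - affcoord a) / enorm (y - affcoord a)).

Definition Hilbert Omega x y : R :=
  2^-1 * (Funk Omega x y + Funk Omega y x).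

End FunkHilbert.

(* Main.v *)
Require Import Defs.
From mathcomp Require Import all_boot all_order all_algebra.
From mathcomp Require Import all_classical all_reals all_analysis.
From mathcomp Require Import ring lra.

Import Order.TTheory GRing.Theory Num.Theory.
Import numFieldNormedType.Exports.

Set Implicit Arguments.
Unset Strict Implicit.
Unset Printing Implicit Defensive.

Local Open Scope classical_set_scope.
Local Open Scope ring_scope.

(** The idea is to replace the metric by a multiplicative quantity attached to
    homogeneous coordinates. Write [x^] for the vector [(1, x)], and let
    [g(x, v)] be the Minkowski gauge of [Omega - x] at [v], so that for [u >= 0]
    the point [x + u v] lies in [Omega] iff [u * g(x, v) < 1]
    ([mem_ray_gauge]). Put [kappa(x, y) = 1 - g(x, y - x)], a number in
    [(0, 1]]. Whether the boundary point [a(x, y)] is finite or at infinity, it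
    is the class of [y^ - kappa(x, y) x^] ([bdptE]), and the Funk distance from
    [x] to [y] is [- ln kappa(x, y)] ([FunkE]).

    By convexity, [kappa(x, y) * kappa(y, z) <= kappa(x, z)]
    ([kappa_triangle]): this is the triangle inequality for the Funk metric.
    Applied to [(x, y, z)] and to [(z, y, x)], it shows that equality holds in
    the triangle inequality for the Hilbert metric iff both inequalities
    between kappas are equalities.

    The boundary points are governed by the identity
    [z^ - kappa(x, z) x^ = (z^ - kappa(y, z) y^)
       + kappa(y, z) (y^ - kappa(x, y) x^)
       + (kappa(x, y) kappa(y, z) - kappa(x, z)) x^].
    If the last coefficient vanishes, the three representatives are dependent,
    hence the points are aligned. If it does not, a plane containing the three
    representatives contains [x^], then [y^] and [z^], so that [x], [y] and [z]
    are collinear. For non-collinear points, alignment is therefore equivalent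
    to equality of the kappas ([aligned_nonspan]). For collinear points all the
    boundary points lie on the line through [x] and [y] ([aligned_span]), and
    equality always holds when [y] is between [x] and [z], or when the whole
    line is contained in [Omega] ([kappa_collinear]). *)

(** * Convexity and the gauge of a convex domain seen from a point *)

Lemma convex_comb (R : realType) (n : nat) (Omega : set 'rV[R]_n)
    (p q : 'rV[R]_n) (a : R) :
  convex_set (Omega : set (convex_lmodType 'rV[R]_n)) ->
  Omega p -> Omega q -> 0 <= a -> a <= 1 -> Omega (a *: p + (1 - a) *: q).
Proof.
move=> conv Op Oq a0 a1.
by have /set_mem := conv p q (Itv01 a0 a1) (mem_set Op) (mem_set Oq).
Qed.

Lemma near_line (R : realType) (n : nat) (Omega : set 'rV[R]_n)
    (x v : 'rV[R]_n) (t : R) :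
  nbhs (x + t *: v) Omega -> \forall u \near t, Omega (x + u *: v).
Proof.
move=> nO.
have : (fun u : R => x + u *: v) @ t --> x + t *: v.
  apply: cvgD; first exact: cvg_cst.
  exact: scalel_continuous.
by apply.
Qed.

(** The segment from a point of an open convex set to a point of its closure
    stays in the set, its end excepted. *)
Lemma convex_closure_comb (R : realType) (n : nat) (Omega : set 'rV[R]_n)
    (x p : 'rV[R]_n) (a : R) :
  convex_set (Omega : set (convex_lmodType 'rV[R]_n)) -> open Omega ->
  Omega x -> closure Omega p -> 0 <= a -> a < 1 ->
  Omega (x + a *: (p - x)).
Proof.
move=> conv op Ox clp a0 a1.
have a1' : 1 - a != 0 by rewrite subr_eq0 gt_eqF.
(* [f q] is the point such that [x + a (p - x)] divides the segment from [f q]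
   to [q] in the ratio [a]; as [f p = x], points [q] of [Omega] close to [p]
   have [f q] in [Omega]. *)
pose f (q : 'rV[R]_n) := (1 - a)^-1 *: (x + a *: (p - x) - a *: q).
have fp : f p = x.
  by rewrite /f; apply/rowP => i; rewrite !mxE; field.
have /clp [q [Oq Ofq]] : nbhs p (f @^-1` Omega).
  have : continuous f.
    move=> q; apply: (@cvgZ _ _ _ _ (nbhs_filter q)); first exact: cvg_cst.
    apply: (@cvgB _ _ _ _ (nbhs_filter q)); first exact: cvg_cst.
    exact: scaler_continuous.
  move=> /(_ p); apply; rewrite fp; exact: (open_nbhs_nbhs (conj op Ox)).
have -> : x + a *: (p - x) = a *: q + (1 - a) *: f q.
  by rewrite /f; apply/rowP => i; rewrite !mxE; field.
by apply: convex_comb => //; exact: ltW.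
Qed.

(** The Minkowski gauge of [Omega - x] at [v]: the inverse of the time at which
    the ray from [x] with velocity [v] leaves [Omega], and [0] if it never
    does. *)
Definition gauge {R : realType} {n : nat} (Omega : set 'rV[R]_n)
    (x v : 'rV[R]_n) : R :=
  inf [set r : R | 0 < r /\ Omega (x + r^-1 *: v)].

Lemma gauge_nonempty (R : realType) (n : nat) (Omega : set 'rV[R]_n)
    (x v : 'rV[R]_n) : open Omega -> Omega x ->
  [set r : R | 0 < r /\ Omega (x + r^-1 *: v)] !=set0.
Proof.
move=> op Ox.
have : \forall u \near (0 : R), Omega (x + u *: v).
  apply: near_line; rewrite scale0r addr0.
  exact: (open_nbhs_nbhs (conj op Ox)).
move=> /nbhs_ballP[e /= e0 be].
exists (e / 2)^-1; split; first by rewrite invr_gt0 divr_gt0.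
rewrite invrK; apply: be; rewrite /ball /= sub0r normrN gtr0_norm ?divr_gt0//.
by lra.
Qed.

Lemma gauge_ge0 (R : realType) (n : nat) (Omega : set 'rV[R]_n)
    (x v : 'rV[R]_n) : open Omega -> Omega x -> 0 <= gauge Omega x v.
Proof.
move=> op Ox; apply: lb_le_inf; first exact: gauge_nonempty.
by move=> r [/ltW].
Qed.

(** The strict inequality encodes that [Omega] is open; a zero gauge means that
    the whole ray is contained in [Omega]. *)
Lemma mem_ray_gauge (R : realType) (n : nat) (Omega : set 'rV[R]_n)
    (x v : 'rV[R]_n) (u : R) :
  convex_set (Omega : set (convex_lmodType 'rV[R]_n)) -> open Omega ->
  Omega x -> 0 <= u ->
  Omega (x + u *: v) <-> u * gauge Omega x v < 1.
Proof.
move=> conv op Ox; rewrite le_eqVlt => /orP[/eqP <-|u0].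
  by rewrite scale0r addr0 mul0r ltr01.
split=> [Ou|].
- have /nbhs_ballP[e /= e0 be] := near_line (open_nbhs_nbhs (conj op Ou)).
  have Ou' : Omega (x + (u + e / 2) *: v).
    apply: be; rewrite /ball /= opprD addrA subrr sub0r normrN.
    by rewrite gtr0_norm ?divr_gt0//; lra.
  have u'0 : 0 < u + e / 2 by lra.
  have : gauge Omega x v <= (u + e / 2)^-1.
    apply: ge_inf; first by exists 0 => r [/ltW].
    by split; rewrite ?invr_gt0// invrK.
  rewrite -(ler_pM2l u0) => /le_lt_trans; apply.
  by rewrite ltr_pdivrMr// mul1r; lra.
- rewrite mulrC -ltr_pdivlMr// div1r.
  move=> /inf_lt -/(_ (gauge_nonempty v op Ox))[r [r0 Or] ru].
  have -> : x + u *: v = (u * r) *: (x + r^-1 *: v) + (1 - u * r) *: x.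
    by apply/rowP => i; rewrite !mxE; field; rewrite gt_eqF.
  apply: convex_comb => //; first by rewrite mulr_ge0// ltW.
  by rewrite mulrC -ler_pdivlMr// div1r ltW.
Qed.

Lemma gauge_unique (R : realType) (n : nat) (Omega : set 'rV[R]_n)
    (x v : 'rV[R]_n) (s : R) :
  convex_set (Omega : set (convex_lmodType 'rV[R]_n)) -> open Omega ->
  Omega x -> 0 <= s ->
  (forall u, 0 <= u -> Omega (x + u *: v) <-> u * s < 1) ->
  gauge Omega x v = s.
Proof.
move=> conv op Ox s0 hs; have g0 := gauge_ge0 v op Ox.
have key (a b : R) : 0 <= a -> 0 <= b ->
    (forall u, 0 <= u -> u * a < 1 -> u * b < 1) -> b <= a.
  move=> a0 b0 h; rewrite leNgt; apply/negP => ab.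
  have bp : 0 < b by exact: le_lt_trans ab.
  have := h b^-1; rewrite invr_ge0 b0 mulVf ?gt_eqF// ltxx mulrC.
  by rewrite ltr_pdivrMr// mul1r => /(_ isT ab).
apply/le_anti/andP; split; apply: key => // u u0.
- by move=> /(hs _ u0) Ou; apply/(mem_ray_gauge _ conv op Ox u0).
- by move=> /(mem_ray_gauge _ conv op Ox u0) Ou; apply/(hs _ u0).
Qed.

(** * Points of projective space *)

Lemma RPclassZ (R : realType) (n : nat) (k : R) (v : 'rV[R]_(1 + n)) :
  k != 0 -> RPclass (k *: v) = RPclass v.
Proof.
move=> k0; rewrite /RPclass; congr insubd; apply/eqP; rewrite eqEsubv.
apply/andP; split; rewrite -memvE; first by rewrite memvZ// memv_line.
by rewrite -{1}(scalerK k0 v) memvZ// memv_line.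
Qed.

Lemma row_mx1_neq0 (R : realType) (n : nat) (a : 'rV[R]_n) :
  row_mx (1 : 'M[R]_1) a != 0.
Proof.
by apply/eqP; rewrite -row_mx0 => /eq_row_mx[/eqP]; rewrite oner_eq0.
Qed.

Lemma affpt_inj (R : realType) (n : nat) : injective (@affpt R n).
Proof.
move=> a b /(congr1 val); rewrite !val_RPclass ?row_mx1_neq0// => ab.
have /vlineP[k] : row_mx 1 a \in <[row_mx 1 b : 'rV[R]_(1 + n)]>%VS.
  by rewrite -ab memv_line.
rewrite scale_row_mx => /eq_row_mx[/matrixP/(_ 0 0)].
by rewrite !mxE /= mulr1 => <- ->; rewrite scale1r.
Qed.

Lemma Hinf_infpt (R : realType) (n : nat) (v : 'rV[R]_n) :
  v != 0 -> Hinf (infpt v).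
Proof.
move=> v0 [a _ /(congr1 val)].
have v'0 : row_mx (0 : 'M[R]_1) v != 0.
  by apply: contra_neq v0; rewrite -row_mx0 => /eq_row_mx[].
rewrite !val_RPclass ?row_mx1_neq0// => av.
have /vlineP[k] : row_mx 1 a \in <[row_mx 0 v : 'rV[R]_(1 + n)]>%VS.
  by rewrite -av memv_line.
rewrite scale_row_mx scaler0 => /eq_row_mx[/eqP].
by rewrite oner_eq0.
Qed.

Lemma affcoordK (R : realType) (n : nat) (a : 'rV[R]_n) :
  affcoord (affpt a) = a.
Proof. by apply: get_unique => // b /affpt_inj. Qed.

Lemma enormZ (R : realType) (n : nat) (k : R) (v : 'rV[R]_n) :
  enorm (k *: v) = `|k| * enorm v.
Proof.
rewrite /enorm -sqrtr_sqr -sqrtrM ?sqr_ge0// mulr_sumr.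
by congr Num.sqrt; apply: eq_bigr => i _; rewrite mxE exprMn.
Qed.

Lemma enorm_neq0 (R : realType) (n : nat) (v : 'rV[R]_n) :
  v != 0 -> enorm v != 0.
Proof.
apply: contra_neq => /eqP; rewrite sqrtr_eq0 => v0.
have {}v0 : \sum_(i < n) v 0 i ^+ 2 == 0.
  by rewrite eq_le v0 sumr_ge0// => i _; exact: sqr_ge0.
apply/rowP => i; rewrite mxE; apply/eqP; rewrite -sqrf_eq0.
rewrite psumr_eq0 in v0 => [|j _]; last exact: sqr_ge0.
exact: (allP v0) (mem_index_enum _).
Qed.

(** * Boundary points and the Funk metric in homogeneous coordinates *)

Lemma bdpt_infpt (R : realType) (n : nat) (Omega : set 'rV[R]_n)
    (x y : 'rV[R]_n) :
  convex_set (Omega : set (convex_lmodType 'rV[R]_n)) -> open Omega ->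
  Omega x -> gauge Omega x (y - x) = 0 -> bdpt Omega x y = infpt (y - x).
Proof.
move=> conv op Ox g0; rewrite /bdpt ifT//; apply/asboolP => _ [t /= t0 <-].
by apply/(mem_ray_gauge _ conv op Ox t0); rewrite g0 mulr0.
Qed.

(** If the ray leaves [Omega], it meets the boundary at the single point of
    parameter [(gauge Omega x (y - x))^-1]. *)
Lemma bdpt_affpt (R : realType) (n : nat) (Omega : set 'rV[R]_n)
    (x y : 'rV[R]_n) :
  convex_set (Omega : set (convex_lmodType 'rV[R]_n)) -> open Omega ->
  Omega x -> gauge Omega x (y - x) != 0 ->
  bdpt Omega x y = affpt (x + (gauge Omega x (y - x))^-1 *: (y - x)).
Proof.
move=> conv op Ox; have memP := mem_ray_gauge (y - x) conv op Ox.
have := gauge_ge0 (y - x) op Ox.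
set s := gauge _ _ _ in memP * => s_ge0 s_neq0.
have s0 : 0 < s by rewrite lt_neqAle eq_sym s_neq0.
have r0 : 0 < s^-1 by rewrite invr_gt0.
have nOa : ~ Omega (x + s^-1 *: (y - x)).
  by move=> /(memP _ (ltW r0)); rewrite mulVf// ltxx.
rewrite /bdpt ifF; last first.
  by apply/asboolPn => sub; apply/nOa/sub; exists s^-1 => //=; exact: ltW.
congr affpt; apply: get_unique => [|_ [[t /= t0 <-]]].
  split; first by exists s^-1 => //=; exact: ltW.
  split; last by move=> /interior_subset.
  (* Points of the ray with parameter slightly below [s^-1] are in [Omega]. *)
  move=> B /near_line nB.
  have : \forall u \near s^-1^'-,
      Omega (x + u *: (y - x)) /\ B (x + u *: (y - x)).
    near=> u; split; last by near: u; exact: cvg_within.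
    apply/memP; first by near: u; exact: nbhs_left_ge.
    rewrite -ltr_pdivlMr// div1r; near: u; exact: nbhs_left_lt.
  by move=> /filter_ex[u [Ou Bu]]; exists (x + u *: (y - x)).
move=> [cl nint].
have nOt : ~ Omega (x + t *: (y - x)).
  by move=> Ot; apply: nint; exact: (open_nbhs_nbhs (conj op Ot)).
suff -> : t = s^-1 by [].
apply/le_anti/andP; split; rewrite leNgt; apply/negP => ts.
(* A closure point beyond parameter [s^-1] would put the point of parameter
   [s^-1] in [Omega]. *)
- apply: nOa; have t0' : 0 < t by exact: lt_trans ts.
  have -> : x + s^-1 *: (y - x) =
      x + (s^-1 / t) *: (x + t *: (y - x) - x).
    by apply/rowP => i; rewrite !mxE; field; rewrite s_neq0 gt_eqF.
  apply: convex_closure_comb => //; first by rewrite divr_ge0// ltW.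
  by rewrite ltr_pdivrMr// mul1r.
- by apply/nOt/memP => //; rewrite -ltr_pdivlMr// div1r.
Unshelve. all: by end_near. Qed.

(** The homogeneous coordinates [(1, x)] of the affine point [x]. *)
Definition homog {R : realType} {n : nat} (x : 'rV[R]_n) : 'rV[R]_(1 + n) :=
  row_mx 1 x.

(** The exponential of minus the Funk distance: for [x] and [y] in [Omega], the
    largest [k <= 1] such that [homog y - k *: homog x] is in the closure of
    the cone over [Omega]. *)
Definition kappa {R : realType} {n : nat} (Omega : set 'rV[R]_n)
    (x y : 'rV[R]_n) : R := 1 - gauge Omega x (y - x).

Lemma kappa_gt0 (R : realType) (n : nat) (Omega : set 'rV[R]_n)
    (x y : 'rV[R]_n) :
  convex_set (Omega : set (convex_lmodType 'rV[R]_n)) -> open Omega ->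
  Omega x -> Omega y -> 0 < kappa Omega x y.
Proof.
move=> conv op Ox Oy.
have /(mem_ray_gauge _ conv op Ox ler01) : Omega (x + 1 *: (y - x)).
  by rewrite scale1r subrKC.
by rewrite mul1r /kappa subr_gt0.
Qed.

Lemma homog_comb_neq0 (R : realType) (n : nat) (x y : 'rV[R]_n) (k : R) :
  x != y -> homog y - k *: homog x != 0.
Proof.
apply: contra_neq; rewrite scale_row_mx opp_row_mx add_row_mx -row_mx0.
move=> /eq_row_mx[/matrixP/(_ 0 0)]; rewrite !mxE /= mulr1 => k1.
by rewrite (_ : k = 1) ?scale1r; [move/subr0_eq|lra].
Qed.

(** A single formula for both kinds of boundary points: the first coordinate of
    the representative is [1 - kappa Omega x y], which vanishes exactly when
    the ray stays in [Omega]. *)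
Lemma bdptE (R : realType) (n : nat) (Omega : set 'rV[R]_n)
    (x y : 'rV[R]_n) :
  convex_set (Omega : set (convex_lmodType 'rV[R]_n)) -> open Omega ->
  Omega x ->
  bdpt Omega x y = RPclass (homog y - kappa Omega x y *: homog x).
Proof.
move=> conv op Ox; rewrite /kappa.
have [g0|g0] := eqVneq (gauge Omega x (y - x)) 0.
  rewrite bdpt_infpt// g0 subr0 scale1r /infpt; congr RPclass.
  by rewrite /homog opp_row_mx add_row_mx subrr.
rewrite bdpt_affpt// /affpt -[RHS](RPclassZ _ (invr_neq0 g0)); congr RPclass.
set s := gauge _ _ _ in g0 *.
rewrite /homog scale_row_mx opp_row_mx add_row_mx scale_row_mx.
by congr row_mx; apply/matrixP => i j; rewrite !mxE; field.
Qed.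

Lemma FunkE (R : realType) (n : nat) (Omega : set 'rV[R]_n)
    (x y : 'rV[R]_n) :
  convex_set (Omega : set (convex_lmodType 'rV[R]_n)) -> open Omega ->
  Omega x -> Omega y -> x != y ->
  Funk Omega x y = - ln (kappa Omega x y).
Proof.
move=> conv op Ox Oy xy; have := kappa_gt0 conv op Ox Oy.
rewrite /Funk (negPf xy) /kappa => k0.
have [g0|g0] := eqVneq (gauge Omega x (y - x)) 0.
  rewrite bdpt_infpt// ifT ?g0 ?subr0 ?ln1 ?oppr0//.
  by apply/asboolP/Hinf_infpt; rewrite subr_eq0 eq_sym.
rewrite bdpt_affpt// ifF; last first.
  by apply/asboolPn => /(_ (ex_intro2 _ _ _ I erefl)).
rewrite affcoordK -lnV ?posrE//; congr ln.
have := gauge_ge0 (y - x) op Ox.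
set s := gauge _ _ _ in g0 k0 * => s0.
have {}s0 : 0 < s by rewrite lt_neqAle eq_sym g0.
have -> : x - (x + s^-1 *: (y - x)) = - s^-1 *: (y - x).
  by apply/rowP => i; rewrite !mxE; ring.
have -> : y - (x + s^-1 *: (y - x)) = (- ((1 - s) / s)) *: (y - x).
  by apply/rowP => i; rewrite !mxE; field.
have e0 : enorm (y - x) != 0 by apply: enorm_neq0; rewrite subr_eq0 eq_sym.
rewrite !enormZ !normrN !gtr0_norm ?invr_gt0 ?divr_gt0//.
by field; rewrite e0 g0 gt_eqF.
Qed.

(** * The triangle inequality *)

(** The exponential form of the triangle inequality for the Funk metric. *)
Lemma kappa_triangle (R : realType) (n : nat) (Omega : set 'rV[R]_n)
    (x y z : 'rV[R]_n) :
  convex_set (Omega : set (convex_lmodType 'rV[R]_n)) -> open Omega ->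
  Omega x -> Omega y -> Omega z ->
  kappa Omega x y * kappa Omega y z <= kappa Omega x z.
Proof.
move=> conv op Ox Oy Oz.
have k_xy := kappa_gt0 conv op Ox Oy; have k_yz := kappa_gt0 conv op Oy Oz.
have k_xz := kappa_gt0 conv op Ox Oz.
(* The condition [k < kappa u v] says that the point with homogeneous
   coordinates [homog v - k *: homog u] is in [Omega]. *)
have memk u v k : Omega u -> k < 1 ->
    Omega (u + (1 - k)^-1 *: (v - u)) <-> k < kappa Omega u v.
  move=> Ou k1; have k1' : 0 < 1 - k by rewrite subr_gt0.
  have k1'' : 0 <= (1 - k)^-1 by rewrite invr_ge0 ltW.
  apply: (iff_trans (mem_ray_gauge (v - u) conv op Ou k1'')).
  rewrite mulrC ltr_pdivrMr// mul1r /kappa.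
  by split=> ?; lra.
have kle1 u v : Omega u -> kappa Omega u v <= 1.
  by move=> Ou; rewrite /kappa gerBl gauge_ge0.
rewrite leNgt; apply/negP => lt_k.
set a := kappa Omega x y in k_xy lt_k *.
set b := kappa Omega y z in k_yz lt_k *.
set c := kappa Omega x z in k_xz lt_k *.
(* With this scaling, [l * a < a], [l * b < b] and [(l * a) * (l * b) = c]: the
   first two inequalities give [c < c]. *)
pose l := Num.sqrt (c / (a * b)).
have ab0 : 0 < a * b by rewrite mulr_gt0.
have l0 : 0 < l by rewrite sqrtr_gt0 divr_gt0.
have l2 : l * l = c / (a * b) by rewrite -expr2 sqr_sqrtr// ltW// divr_gt0.
have l1 : l < 1.
  by rewrite -sqrtr1 ltr_sqrt// ltr_pdivrMr// mul1r.
have la : l * a < a by rewrite gtr_pMl.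
have lb : l * b < b by rewrite gtr_pMl.
have la1 : l * a < 1 by exact: lt_le_trans la (kle1 _ _ Ox).
have lb1 : l * b < 1 by exact: lt_le_trans lb (kle1 _ _ Oy).
have /memk - /(_ Ox la1) Op := la.
have /memk - /(_ Oy lb1) Oq := lb.
have cE : c = (l * a) * (l * b).
  by rewrite mulrACA l2 divfK// gt_eqF.
have c1 : c < 1.
  by rewrite cE mulr_ilt1// ltW// mulr_gt0.
have c1' : 1 - c != 0 by rewrite subr_eq0 gt_eqF.
suff : Omega (x + (1 - c)^-1 *: (z - x)).
  by move=> /(memk _ _ _ Ox c1); rewrite ltxx.
(* [homog z - c *: homog x] is the sum of [homog z - l b *: homog y] and of
   [l b] times [homog y - l a *: homog x]; normalizing yields a convex
   combination. *)
have -> : x + (1 - c)^-1 *: (z - x) =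
   ((1 - l * b) / (1 - c)) *: (y + (1 - l * b)^-1 *: (z - y)) +
   (1 - (1 - l * b) / (1 - c)) *: (x + (1 - l * a)^-1 *: (y - x)).
  have la1' : 1 - l * a != 0 by rewrite subr_eq0 gt_eqF.
  have lb1' : 1 - l * b != 0 by rewrite subr_eq0 gt_eqF.
  move: c1'; rewrite cE => c1'.
  by apply/rowP => i; rewrite !mxE; field; rewrite c1' la1' lb1'.
apply: convex_comb => //.
  by rewrite divr_ge0// subr_ge0 ltW.
rewrite ler_pdivrMr ?subr_gt0// mul1r lerD2l lerN2 cE.
by rewrite ger_pMl ?mulr_gt0// ltW.
Qed.

(** * Alignment *)

Lemma dim_add_vline (K : fieldType) (vT : vectType K) (u v : vT) :
  u != 0 -> v \notin <[u]>%VS -> \dim (<[u]> + <[v]>)%VS = 2%N.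
Proof.
move=> u0 vu; have v0 : v != 0 by apply: contraNneq vu => ->; exact: mem0v.
rewrite dimv_disjoint_sum ?dim_vline ?u0 ?v0//.
apply/eqP; rewrite -subv0; apply/subvP => w; rewrite memv_cap memv0.
move=> /andP[wu /vlineP[k wE]].
have [k0|k0] := eqVneq k 0; first by rewrite wE k0 scale0r.
suff : v \in <[u]>%VS by rewrite (negPf vu).
by rewrite -[v](scalerK k0) -wE memvZ.
Qed.

Lemma dim_homog_span (R : realType) (n : nat) (x y : 'rV[R]_n) :
  x != y -> \dim (<[homog x]> + <[homog y]>)%VS = 2%N.
Proof.
move=> xy; apply: dim_add_vline; first exact: row_mx1_neq0.
apply/negP => /vlineP[k yE]; have := homog_comb_neq0 k xy.
by rewrite yE subrr eqxx.
Qed.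

Lemma homog_span_sym (R : realType) (n : nat) (x y z : 'rV[R]_n) :
  x != y -> z != y -> homog z \in (<[homog x]> + <[homog y]>)%VS ->
  homog x \in (<[homog z]> + <[homog y]>)%VS.
Proof.
move=> xy zy zW.
have /eqP -> : (<[homog z]> + <[homog y]>)%VS == (<[homog x]> + <[homog y]>)%VS.
  by rewrite eqEdim !dim_homog_span// leqnn andbT subv_add -memvE zW addvSr.
by rewrite memvE addvSl.
Qed.

(** For collinear [x], [y], [z], all the points involved lie on one projective
    line. *)
Lemma aligned_span (R : realType) (n : nat) (x y z : 'rV[R]_n) (a b c : R) :
  x != y -> y != z -> x != z ->
  homog z \in (<[homog x]> + <[homog y]>)%VS ->
  aligned (RPclass (homog y - a *: homog x)) (RPclass (homog z - b *: homog y))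
    (RPclass (homog z - c *: homog x)).
Proof.
move=> xy yz xz zW; exists (<[homog x]> + <[homog y]>)%VS.
have xW : homog x \in (<[homog x]> + <[homog y]>)%VS.
  by rewrite memvE addvSl.
have yW : homog y \in (<[homog x]> + <[homog y]>)%VS.
  by rewrite memvE addvSr.
rewrite dim_homog_span// !val_RPclass ?homog_comb_neq0//.
by split=> //; rewrite -memvE memvB// memvZ.
Qed.

(** For non-collinear [x], [y], [z], the three representatives are linearly
    dependent iff [a * b = c]. *)
Lemma aligned_nonspan (R : realType) (n : nat) (x y z : 'rV[R]_n)
    (a b c : R) :
  x != y -> y != z -> x != z ->
  homog z \notin (<[homog x]> + <[homog y]>)%VS ->
  aligned (RPclass (homog y - a *: homog x)) (RPclass (homog z - b *: homog y))
    (RPclass (homog z - c *: homog x)) <-> a * b = c.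
Proof.
move=> xy yz xz zW; rewrite /aligned !val_RPclass ?homog_comb_neq0//.
set u := homog y - a *: homog x; set v := homog z - b *: homog y.
have uvE : homog z - c *: homog x = v + b *: u + (a * b - c) *: homog x.
  by rewrite /u /v; apply/rowP => i; rewrite !mxE; ring.
split=> [[W [dimW]]|abc].
  rewrite -!memvE => uW vW wW; apply/eqP; rewrite -subr_eq0.
  apply: contraNT zW => d0.
  have xW : homog x \in W.
    rewrite -[homog x](scalerK d0) memvZ//.
    have -> : (a * b - c) *: homog x = homog z - c *: homog x - (v + b *: u).
      by rewrite uvE addrAC subrr add0r.
    by rewrite memvB// memvD// memvZ.
  have yW : homog y \in W.
    by rewrite -[homog y](subrK (a *: homog x)) memvD// memvZ.
  have zW : homog z \in W.
    by rewrite -[homog z](subrK (b *: homog y)) memvD// memvZ.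
  suff -> : (<[homog x]> + <[homog y]>)%VS = W by [].
  apply/eqP; rewrite eqEdim dim_homog_span// dimW leqnn andbT.
  by rewrite subv_add -!memvE xW.
(* [u] and [v] span a plane, since otherwise [homog z] would be in the span of
   [homog x] and [homog y]. *)
have vu : v \notin <[u]>%VS.
  apply: contra zW => /vlineP[k vE].
  have -> : homog z = k *: u + b *: homog y by rewrite -vE subrK.
  apply/memv_addP; exists (- (k * a) *: homog x).
    by rewrite memvZ// memv_line.
  exists ((k + b) *: homog y); first by rewrite memvZ// memv_line.
  by rewrite /u; apply/rowP => i; rewrite !mxE; ring.
exists (<[u]> + <[v]>)%VS.
have uW : u \in (<[u]> + <[v]>)%VS by rewrite memvE addvSl.
have vW : v \in (<[u]> + <[v]>)%VS by rewrite memvE addvSr.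
rewrite dim_add_vline ?homog_comb_neq0// -!memvE; split=> //.
by rewrite uvE abc subrr scale0r addr0 memvD// memvZ.
Qed.

Lemma alignedC (R : realType) (n : nat) (p q r : RPspace R n) :
  aligned p q r -> aligned q p r.
Proof. by case=> W [? ? ? ?]; exists W. Qed.

Lemma homog_span_collinear (R : realType) (n : nat) (x y z : 'rV[R]_n) :
  x != z -> homog z \in (<[homog x]> + <[homog y]>)%VS ->
  exists t, y = x + t *: (z - x).
Proof.
move=> xz /memv_addP[_ /vlineP[b ->] [_ /vlineP[a ->]]].
rewrite /homog !scale_row_mx add_row_mx => /eq_row_mx[/matrixP/(_ 0 0)].
rewrite !mxE /= !mulr1 => ba zE; have bE : b = 1 - a by lra.
have a0 : a != 0.
  by apply: contra_neq xz => a0; rewrite zE bE a0 subr0 scale0r addr0 scale1r.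
by exists a^-1; rewrite zE bE; apply/rowP => i; rewrite !mxE; field.
Qed.

(** * Collinear triples and the conclusion *)

Lemma kappa_between (R : realType) (n : nat) (Omega : set 'rV[R]_n)
    (x y z : 'rV[R]_n) (t : R) :
  convex_set (Omega : set (convex_lmodType 'rV[R]_n)) -> open Omega ->
  Omega x -> Omega y -> Omega z -> 0 <= t <= 1 -> y = x + t *: (z - x) ->
  kappa Omega x y * kappa Omega y z = kappa Omega x z.
Proof.
move=> conv op Ox Oy Oz /andP[t0 t1] yE.
have s0 := gauge_ge0 (z - x) op Ox.
have memP := mem_ray_gauge (z - x) conv op Ox.
have := kappa_gt0 conv op Ox Oz; rewrite /kappa subr_gt0.
set s := gauge Omega x (z - x) in s0 memP * => s1.
have ts : 0 < 1 - t * s by rewrite subr_gt0; apply/(memP _ t0); rewrite -yE.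
(* The three rays run along one line; comparing exit times gives the other two
   gauges in terms of [s]. *)
have -> : gauge Omega x (y - x) = t * s.
  apply: gauge_unique => // [|u u0]; first exact: mulr_ge0.
  by rewrite mulrA yE addrAC subrr add0r scalerA; apply/memP/mulr_ge0.
have -> : gauge Omega y (z - y) = (1 - t) * s / (1 - t * s).
  apply: gauge_unique => // [|u u0].
    by rewrite divr_ge0 ?(ltW ts)// mulr_ge0// subr_ge0.
  have -> : y + u *: (z - y) = x + (t + u * (1 - t)) *: (z - x).
    by rewrite yE; apply/rowP => i; rewrite !mxE; ring.
  rewrite mulrA ltr_pdivrMr// mul1r.
  apply: iff_trans (memP _ _) _.
    by rewrite addr_ge0// mulr_ge0// subr_ge0.
  by split=> ?; lra.
by field; rewrite gt_eqF.
Qed.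

Lemma kappa_line (R : realType) (n : nat) (Omega : set 'rV[R]_n)
    (x y : 'rV[R]_n) :
  convex_set (Omega : set (convex_lmodType 'rV[R]_n)) -> open Omega ->
  (forall s : R, Omega (x + s *: (y - x))) -> kappa Omega x y = 1.
Proof.
move=> conv op line; rewrite /kappa (@gauge_unique _ _ _ _ _ 0) ?subr0//.
  by have := line 0; rewrite scale0r addr0.
by move=> u _; rewrite mulr0; split.
Qed.

Lemma kappa_collinear (R : realType) (n : nat) (Omega : set 'rV[R]_n)
    (x y z : 'rV[R]_n) (t : R) :
  convex_set (Omega : set (convex_lmodType 'rV[R]_n)) -> open Omega ->
  Omega x -> Omega y -> Omega z -> y = x + t *: (z - x) ->
  (0 <= t <= 1) \/ (forall s : R, Omega (x + s *: (z - x))) ->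
  kappa Omega x y * kappa Omega y z = kappa Omega x z.
Proof.
move=> conv op Ox Oy Oz yE [t01|line]; first exact: (kappa_between (t := t)).
rewrite !kappa_line ?mulr1// => s; rewrite yE.
- have -> : x + t *: (z - x) + s *: (z - (x + t *: (z - x))) =
      x + (t + s * (1 - t)) *: (z - x).
    by apply/rowP => i; rewrite !mxE; ring.
  exact: line.
- by rewrite addrAC subrr add0r scalerA.
Qed.

(** Two triangle inequalities are both equalities as soon as the half-sum is
    one. *)
Lemma half_sumE (R : realType) (a b c a' b' c' : R) :
  a + b <= c -> a' + b' <= c' ->
  2^-1 * (- a + - b') + 2^-1 * (- b + - a') = 2^-1 * (- c + - c') <->
  a + b = c /\ a' + b' = c'.
Proof. by move=> abc abc'; split=> [?|[? ?]]; [split|]; lra. Qed.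

(* The literal claim fails exactly for collinear triples with y outside [x, z]
   on a line not contained in Omega: there the boundary points all lie on that
   line, hence are aligned, but the triangle inequality is strict. The last
   hypothesis excludes these triples and nothing else. *)
Theorem theorem12p4 (R : realType) (n : nat) (Omega : set 'rV[R]_n)
    (hOmega : proper_convex_domain Omega) (x y z : 'rV[R]_n)
    (hx : Omega x) (hy : Omega y) (hz : Omega z)
    (hxy : x <> y) (hyz : y <> z) (hxz : x <> z)
    (hcol : forall t : R, y = x + t *: (z - x) ->
       (0 <= t <= 1) \/ (forall s : R, Omega (x + s *: (z - x)))) :
  Hilbert Omega x y + Hilbert Omega y z = Hilbert Omega x z <->
  aligned (bdpt Omega x y) (bdpt Omega y z) (bdpt Omega x z) /\
  aligned (bdpt Omega y x) (bdpt Omega z y) (bdpt Omega z x).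
Proof.
have [_ op conv _] := hOmega.
move/eqP: (hxy) => xy; move/eqP: (hyz) => yz; move/eqP: (hxz) => xz.
have yx : y != x by rewrite eq_sym.
have zy : z != y by rewrite eq_sym.
have zx : z != x by rewrite eq_sym.
(* The Hilbert equality is the conjunction of the two Funk equalities. *)
have HilbertE : Hilbert Omega x y + Hilbert Omega y z = Hilbert Omega x z <->
    kappa Omega x y * kappa Omega y z = kappa Omega x z /\
    kappa Omega z y * kappa Omega y x = kappa Omega z x.
  have kpos u v : Omega u -> Omega v -> kappa Omega u v \is Num.pos.
    by move=> Ou Ov; rewrite posrE kappa_gt0.
  have k2pos u v w : Omega u -> Omega v -> Omega w ->
      kappa Omega u v * kappa Omega v w \is Num.pos.
    by move=> Ou Ov Ow; rewrite posrE mulr_gt0// kappa_gt0.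
  have lnk u v w : Omega u -> Omega v -> Omega w ->
      ln (kappa Omega u v * kappa Omega v w) =
      ln (kappa Omega u v) + ln (kappa Omega v w).
    by move=> Ou Ov Ow; rewrite lnM ?kpos.
  have le_lnk u v w : Omega u -> Omega v -> Omega w ->
      ln (kappa Omega u v) + ln (kappa Omega v w) <= ln (kappa Omega u w).
    move=> Ou Ov Ow; rewrite -lnk// ler_ln ?kpos ?k2pos//.
    exact: kappa_triangle.
  have xyz_le := le_lnk _ _ _ hx hy hz; have zyx_le := le_lnk _ _ _ hz hy hx.
  rewrite /Hilbert !FunkE//; apply: (iff_trans (half_sumE xyz_le zyx_le)).
  rewrite -!lnk//; split=> [[xyzE zyxE]|[-> ->]//].
  by split; apply: ln_inj; rewrite ?kpos ?k2pos.
rewrite HilbertE !bdptE//.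
(* The points [x], [y], [z] are collinear iff [homog z] is in this span. *)
have [zW|zW] := boolP (homog z \in (<[homog x]> + <[homog y]>)%VS).
  have [t yE] := homog_span_collinear xz zW.
  have ht := hcol t yE.
  have yE' : y = z + (1 - t) *: (x - z).
    by rewrite {1}yE; apply/rowP => i; rewrite !mxE; ring.
  have ht' : (0 <= 1 - t <= 1) \/ (forall s : R, Omega (z + s *: (x - z))).
    case: ht => [t01|line]; [left|right => s].
      by rewrite subr_ge0 gerBl andbC.
    have -> : z + s *: (x - z) = x + (1 - s) *: (z - x).
      by apply/rowP => i; rewrite !mxE; ring.
    exact: line.
  have xW := homog_span_sym xy zy zW.
  split=> _; split; [exact: aligned_span|apply/alignedC; exact: aligned_span
    |exact: (kappa_collinear conv op hx hy hz yE)
    |exact: (kappa_collinear conv op hz hy hx yE')].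
have xW : homog x \notin (<[homog z]> + <[homog y]>)%VS.
  by apply: contra zW; exact: homog_span_sym.
rewrite -(aligned_nonspan _ _ _ xy yz xz zW).
rewrite -(aligned_nonspan _ _ _ zy yx zx xW).
by split=> -[? ?]; split=> //; apply: alignedC.
Qed.
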